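(* Let $A$ be an integral domain and $M,P$ two $A$-modules such that $P$ is a PS module. Then $\mathrm{Hom}_A(M,P)$ is a PS module over $A$, provided one of the following two conditions holds: (i) $M$ is finitely generated; (ii) $A$ is a weak GCD domain. In particular, if $A$ is a GCD domain, then the dual $\mathrm{Hom}_A(M,A)$ of any $A$-module $M$ is a PS module.
   Context: All rings are commutative and unitary. For an integral domain $A$, a torsion-free $A$-module $M$ is a PS module (pre-Schreier module) if every equality $ax=by$ with $a,b\in A-\{0\}$ and $x,y\in M-\{0\}$ has a refinement, i.e. there exist $c,d,e\in A$ and $z\in M$ with $a=ce$, $b=cd$, $x=dz$, $y=ez$. An integral domain $A$ is a weak GCD domain if each pair $a,b\in A-\{0\}$ has a maximal common divisor, that is, a common divisor $d$ such that $\gcd(a/d,b/d)=1$ (the only common divisors of $a/d$ and $b/d$ are units). A GCD domain is a domain in which any two nonzero elements have a greatest common divisor. *)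

(* Defs.v *)
From HB Require Import structures.
From mathcomp Require Import all_boot all_algebra.
From mathcomp Require Import boolp.

Set Implicit Arguments.
Unset Strict Implicit.
Unset Printing Implicit Defensive.

Import GRing.Theory.
Local Open Scope ring_scope.

(* Hom_A(M, P) is the library type {linear M -> P}, which is not equipped with
   a module structure there; we give it the pointwise one.  The equality and
   choice structures underlying lmodType come from classical axioms. *)
Section HomModule.
Variables (A : comNzRingType) (M P : lmodType A).
Implicit Types (a b : A) (f g h : {linear M -> P}).

HB.instance Definition _ := gen_eqMixin {linear M -> P}.
HB.instance Definition _ := gen_choiceMixin {linear M -> P}.

Definition hom_zero : {linear M -> P} := \0.
Definition hom_opp f : {linear M -> P} := \- f.
Definition hom_add f g : {linear M -> P} := f \+ g.
Definition hom_scale a f : {linear M -> P} := a \*: f.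

Lemma hom_ext f g : f =1 g -> f = g.
Proof.
case: f => f [[fN] [fL]]; case: g => g [[gN] [gL]] /= fg.
have {}fg : f = g by apply/funext.
by subst g; congr (GRing.Linear.Pack (GRing.Linear.Class _ _));
  [rewrite (Prop_irrelevance fN gN) | rewrite (Prop_irrelevance fL gL)].
Qed.

Fact hom_addA : associative hom_add.
Proof. by move=> f g h; apply: hom_ext => x; apply: addrA. Qed.
Fact hom_addC : commutative hom_add.
Proof. by move=> f g; apply: hom_ext => x; apply: addrC. Qed.
Fact hom_add0 : left_id hom_zero hom_add.
Proof. by move=> f; apply: hom_ext => x; apply: add0r. Qed.
Fact hom_addN : left_inverse hom_zero hom_opp hom_add.
Proof. by move=> f; apply: hom_ext => x; apply: addNr. Qed.

HB.instance Definition _ := GRing.isZmodule.Build {linear M -> P}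
  hom_addA hom_addC hom_add0 hom_addN.

Fact hom_scaleA a b f : hom_scale a (hom_scale b f) = hom_scale (a * b) f.
Proof. by apply: hom_ext => x; apply: scalerA. Qed.
Fact hom_scale1 : left_id 1 hom_scale.
Proof. by move=> f; apply: hom_ext => x; apply: scale1r. Qed.
Fact hom_scaleDr : right_distributive hom_scale +%R.
Proof. by move=> a f g; apply: hom_ext => x; apply: scalerDr. Qed.
Fact hom_scaleDl f : {morph hom_scale^~ f : a b / a + b}.
Proof. by move=> a b; apply: hom_ext => x; apply: scalerDl. Qed.

HB.instance Definition _ := GRing.Zmodule_isLmodule.Build A {linear M -> P}
  hom_scaleA hom_scale1 hom_scaleDr hom_scaleDl.

Lemma hom_zeroE x : (0 : {linear M -> P}) x = 0.
Proof. by []. Qed.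
Lemma hom_addE f g x : (f + g) x = f x + g x.
Proof. by []. Qed.
Lemma hom_scaleE a f x : (a *: f) x = a *: f x.
Proof. by []. Qed.

End HomModule.

Definition torsion_free (A : idomainType) (M : lmodType A) : Prop :=
  forall (a : A) (x : M), a != 0 -> x != 0 -> a *: x != 0.

Definition PS_module (A : idomainType) (M : lmodType A) : Prop :=
  torsion_free M /\
  forall (a b : A) (x y : M),
    a != 0 -> b != 0 -> x != 0 -> y != 0 -> a *: x = b *: y ->
    exists (c d e : A) (z : M),
      [/\ a = c * e, b = c * d, x = d *: z & y = e *: z].

Definition finitely_generated (A : idomainType) (M : lmodType A) : Prop :=
  exists (n : nat) (g : 'I_n -> M),
    forall x : M, exists c : 'I_n -> A, x = \sum_(i < n) c i *: g i.

Definition divides (A : idomainType) (d a : A) : Prop := exists q, a = d * q.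

Definition common_divisor (A : idomainType) (d a b : A) : Prop :=
  divides d a /\ divides d b.

Definition is_gcd (A : idomainType) (d a b : A) : Prop :=
  common_divisor d a b /\ forall e, common_divisor e a b -> divides e d.

(* a' and b' are the quotients a/d and b/d, which are unique for d != 0. *)
Definition max_common_divisor (A : idomainType) (d a b : A) : Prop :=
  exists a' b' : A,
    [/\ a = d * a', b = d * b'
      & forall e, common_divisor e a' b' -> e \is a GRing.unit].

Definition weak_GCD_domain (A : idomainType) : Prop :=
  forall a b : A, a != 0 -> b != 0 -> exists d, max_common_divisor d a b.

Definition GCD_domain (A : idomainType) : Prop :=
  forall a b : A, a != 0 -> b != 0 -> exists d, is_gcd d a b.

(* Main.v *)
(** Given [a f = b g] in Hom(M, P), it suffices to write [a = c e], [b = c d]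
    so that every value of [f] is divisible by [d]: torsion-freeness of [P]
    makes the quotient [f / d] a well-defined linear map. If [A] is weak GCD, one
    takes [c] to be a maximal common divisor of [a] and [b], since refining
    [e (f m) = d (g m)] in [P] then splits off only a unit from [d] and [e].
    If [M] is finitely generated, one refines successively on the generators,
    moving the common factor obtained at each step into [c]. *)
Require Import Defs.
From HB Require Import structures.
From mathcomp Require Import all_boot all_algebra.
From mathcomp Require Import boolp.
Import GRing.Theory.
Local Open Scope ring_scope.

Set Implicit Arguments.
Unset Strict Implicit.
Unset Printing Implicit Defensive.

Section TorsionFree.
Variables (A : idomainType) (P : lmodType A).
Hypothesis tfP : torsion_free P.

Lemma torsion_free_scaler_eq0 (a : A) (x : P) : a != 0 -> a *: x = 0 -> x = 0.
Proof.
by move=> a0 ax0; apply/eqP; apply: contraT => /(tfP a0); rewrite ax0 eqxx.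
Qed.

Lemma torsion_free_scalerI (a : A) : a != 0 -> injective ( *:%R a : P -> P).
Proof.
move=> a0 x y axy; apply/eqP; rewrite -subr_eq0; apply/eqP.
by apply: (torsion_free_scaler_eq0 a0); rewrite scalerBr axy subrr.
Qed.

Variable M : lmodType A.

Lemma torsion_free_hom : torsion_free {linear M -> P}.
Proof.
move=> a f a0; apply: contra_neq => af0; apply: hom_ext => m.
by apply: (torsion_free_scaler_eq0 a0); rewrite -hom_scaleE af0.
Qed.

(** Choice selects the quotients pointwise; linearity of the selection is checked after multiplying
    by [d], which is injective on [P]. *)
Lemma hom_divisible (d : A) (f : {linear M -> P}) : d != 0 ->
  (forall m, exists z, f m = d *: z) ->
  exists h : {linear M -> P}, f = d *: h.
Proof.
move=> d0 /choice[h fE].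
have hL : linear h.
  move=> k u v; apply: (torsion_free_scalerI d0).
  by rewrite /= -fE linearP !fE scalerDr !scalerA mulrC.
pose hLin := GRing.isLinear.Build A M P *:%R h hL.
pose h' : {linear M -> P} := HB.pack h hLin.
by exists h'; apply: hom_ext => m; apply: fE.
Qed.

(** Only [f] has to be divided: with [f = d h], both [b g = a f] and [b (e h)] equal [c d e h], and
    cancelling [b] yields [g = e h]. *)
Lemma hom_refinement (a b c d e : A) (f g : {linear M -> P}) :
  b != 0 -> a = c * e -> b = c * d -> a *: f = b *: g ->
  (forall m, exists z, f m = d *: z) ->
  exists (c d e : A) (h : {linear M -> P}),
    [/\ a = c * e, b = c * d, f = d *: h & g = e *: h].
Proof.
move=> b0 aE bE fg fd.
have d0 : d != 0 by apply: contra_neq b0 => d0; rewrite bE d0 mulr0.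
have [h fE] := hom_divisible d0 fd.
exists c, d, e, h; split=> //; apply: hom_ext => m.
apply: (torsion_free_scalerI b0).
by rewrite /= -[LHS]/((b *: g) m) -fg fE aE bE !hom_scaleE !scalerA mulrAC.
Qed.

End TorsionFree.

Section PSModule.
Variables (A : idomainType) (P : lmodType A).
Hypothesis psP : PS_module P.

(** Nonzero homomorphisms may vanish at some points, so refinement of their values must also cover
    zero elements. *)
Lemma PS_module_refinement (a b : A) (x y : P) :
  a != 0 -> b != 0 -> a *: x = b *: y ->
  exists (c d e : A) (z : P),
    [/\ a = c * e, b = c * d, x = d *: z & y = e *: z].
Proof.
case: psP => tfP refP a0 b0 xy.
have [x0|x0] := eqVneq x 0.
  exists 1, b, a, 0; rewrite !mul1r !scaler0; split=> //.
  by apply: (torsion_free_scaler_eq0 tfP b0); rewrite -xy x0 scaler0.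
apply: refP => //; apply: contra_neq x0 => y0.
by apply: (torsion_free_scaler_eq0 tfP a0); rewrite xy y0 scaler0.
Qed.

Lemma PS_module_refinement_finite (a b : A) (n : nat) (x y : nat -> P) :
  a != 0 -> b != 0 -> (forall i, (i < n)%N -> a *: x i = b *: y i) ->
  exists c d e : A, [/\ a = c * e, b = c * d
    & forall i, (i < n)%N -> exists z, x i = d *: z].
Proof.
move=> a0 b0; elim: n => [|n IHn] xy.
  by exists 1, b, a; rewrite !mul1r.
have [|c [d [e [aE bE xd]]]] := IHn.
  by move=> i lt_in; apply: xy; rewrite ltnS ltnW.
move: (a0) (b0); rewrite {1}aE {1}bE !mulf_eq0 !negb_or.
move=> /andP[c0 e0] /andP[_ d0].
have exdy : e *: x n = d *: y n.
  apply: (torsion_free_scalerI (proj1 psP) c0).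
  by rewrite /= !scalerA -aE -bE xy.
(* The new common factor [c'] of [e] and [d] moves into [c]. Since [d'] divides [d], the earlier
   [x i] stay divisible by [d']. *)
have [c' [d' [e' [z [eE dE xE _]]]]] := PS_module_refinement e0 d0 exdy.
exists (c * c'), d', e'; split; first by rewrite aE eE mulrA.
  by rewrite bE dE mulrA.
move=> i; rewrite ltnS leq_eqVlt => /predU1P[->|/xd[w ->]]; first by exists z.
by exists (c' *: w); rewrite dE scalerA mulrC.
Qed.

Variable M : lmodType A.

Lemma PS_module_hom_fg : finitely_generated M -> PS_module {linear M -> P}.
Proof.
case: (psP) => tfP _ [n [s sM]]; split; first exact: torsion_free_hom.
move=> a b f g a0 b0 _ _ fg.
(* The generators are extended to all of [nat] to suit the induction; the default [0] lies beyond
   the range used. *)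
pose t (i : nat) : M := if insub i is Some j then s j else 0.
have fgt i : (i < n)%N -> a *: f (t i) = b *: g (t i).
  by rewrite -!hom_scaleE fg.
have [c [d [e [aE bE fd]]]] :=
  PS_module_refinement_finite a0 b0 fgt.
apply: (hom_refinement tfP b0 aE bE fg) => m.
have fs (j : 'I_n) : exists z, f (s j) = d *: z.
  by have [z] := fd j (ltn_ord j); rewrite /t valK => ?; exists z.
have [z zE] := choice fs.
have [k ->] := sM m; exists (\sum_i k i *: z i).
rewrite linear_sum scaler_sumr; apply: eq_bigr => i _.
by rewrite linearZ_LR zE !scalerA mulrC.
Qed.

Lemma PS_module_hom_weak_GCD :
  weak_GCD_domain A -> PS_module {linear M -> P}.
Proof.
case: (psP) => tfP _ wA; split; first exact: torsion_free_hom.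
move=> a b f g a0 b0 _ _ fg.
have [c [e [d [aE bE ed1]]]] := wA a b a0 b0.
apply: (hom_refinement tfP b0 aE bE fg) => m.
move: (a0) (b0); rewrite {1}aE {1}bE !mulf_eq0 !negb_or.
move=> /andP[c0 e0] /andP[_ d0].
have fgm : e *: f m = d *: g m.
  apply: (torsion_free_scalerI tfP c0).
  by rewrite /= !scalerA -aE -bE -!hom_scaleE fg.
have [u [d' [e' [z [eE dE fE _]]]]] := PS_module_refinement e0 d0 fgm.
(* [u] divides both [e] and [d], whose common divisors are units by maximality of [c]; hence [d] is
   associated with [d'], which divides [f m]. *)
have uU : u \is a GRing.unit by apply: ed1; split; [exists e' | exists d'].
by exists (u^-1 *: z); rewrite fE dE scalerA mulrAC mulrV // mul1r.
Qed.

End PSModule.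

Section GCDDomain.
Variable A : idomainType.
Hypothesis gcdA : GCD_domain A.

Lemma GCD_domain_weak : weak_GCD_domain A.
Proof.
move=> a b a0 b0; have [d [[[a' aE] [b' bE]] dmax]] := gcdA a0 b0.
have d0 : d != 0 by apply: contra_neq a0 => d0; rewrite aE d0 mul0r.
exists d, a', b'; split=> // e [[p pE] [q qE]].
(* If [e] divides both cofactors, then [d * e] divides [a] and [b], hence the gcd [d]; cancelling
   [d] makes [e] invertible. *)
have [|r rE] := dmax (d * e).
  by split; [exists p | exists q]; rewrite -mulrA -?pE -?qE.
apply/unitrPr; exists r; apply: (mulfI d0).
by rewrite mulrA -rE mulr1.
Qed.

(* Coprimality of [a] and [b] forces gcd(a x, b x) to be associated with [x];
   it is divisible by [b] as soon as [b] divides [a x]. *)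
Lemma GCD_domain_gauss (a b x : A) : a != 0 -> b != 0 -> x != 0 ->
  (forall e, common_divisor e a b -> e \is a GRing.unit) ->
  divides b (a * x) -> divides b x.
Proof.
move=> a0 b0 x0 ab1 b_ax.
have [||t [[[p pE] [q qE]] tmax]] := gcdA (a := a * x) (b := b * x).
- by rewrite mulf_neq0.
- by rewrite mulf_neq0.
have [|u tE] := tmax x.
  by split; [exists a | exists b]; rewrite mulrC.
have uU : u \is a GRing.unit.
  apply: ab1; split; [exists p | exists q]; apply: (mulIf x0).
    by rewrite pE tE -mulrA mulrC.
  by rewrite qE tE -mulrA mulrC.
have [|v vE] := tmax b; first by split=> //; exists x.
by exists (v * u^-1); rewrite mulrA -vE tE mulrK.
Qed.

(** Dividing [a x = b y] by a maximal common divisor [c] leaves [e x = d y] with [e], [d] coprime,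
    so Gauss's lemma gives [d] dividing [x]. *)
Lemma GCD_domain_PS : PS_module (A^o : lmodType A).
Proof.
split=> [a x a0 x0|a b x y a0 b0 x0 y0]; first exact: mulf_neq0.
rewrite -[a *: x]/(a * x) -[b *: y]/(b * y) => xy.
have [c [e [d [aE bE ed1]]]] := GCD_domain_weak a0 b0.
move: (a0) (b0); rewrite {1}aE {1}bE !mulf_eq0 !negb_or.
move=> /andP[c0 e0] /andP[_ d0].
have exdy : e * x = d * y by apply: (mulfI c0); rewrite !mulrA -aE -bE.
have [|z xE] := GCD_domain_gauss e0 d0 x0 ed1; first by exists y.
exists c, d, e, z; split=> //; apply: (mulfI d0).
by rewrite -exdy xE mulrCA.
Qed.

End GCDDomain.

Theorem proposition6p1 (A : idomainType) :
  (forall M P : lmodType A,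
     PS_module P ->
     finitely_generated M \/ weak_GCD_domain A ->
     PS_module {linear M -> P}) /\
  (GCD_domain A ->
     forall M : lmodType A, PS_module {linear M -> A^o}).
Proof.
split=> [M P psP [fgM|wA]|gcdA M].
- exact: PS_module_hom_fg.
- exact: PS_module_hom_weak_GCD.
(* The dual is the weak GCD case with [P] the ring itself. *)
- exact: PS_module_hom_weak_GCD (GCD_domain_PS gcdA) _ (GCD_domain_weak gcdA).
Qed.
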